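(* Let $G = (I \cup J, E)$ be a finite bipartite graph with supplies $S_i \in \mathbb{Z}_{\geq 1}$ for $i \in I$ and capacities $C_j \in \mathbb{Z}_{\geq 1}$ for $j \in J$, and suppose that the instance has a perfect matching (i.e. a perfect integral allocation). Let $n := \sum_{i\in I} S_i = \sum_{j \in J} C_j$. Then the instance has a perfect piecewise proportional allocation, that is, a piecewise proportional allocation whose value is equal to $n$.
   Context: An instance consists of a finite bipartite graph $G=(I\cup J,E)$ with bipartition $(I,J)$, integer supplies $S_i\ge 1$ for $i\in I$ and integer capacities $C_j\ge 1$ for $j\in J$. Write $i\sim j$ if $i \in I$ and $j \in J$ are adjacent. A perfect integral allocation (also called a perfect matching of the instance) is an assignment of nonnegative integers $x_{ij}$ to the edges $(i,j)\in E$ such that $\sum_{j\sim i}x_{ij}=S_i$ for every $i\in I$ and $\sum_{i\sim j}x_{ij}=C_j$ for every $j\in J$. A piecewise proportional allocation is an assignment of a weight $\alpha_j\in\mathbb{R}_{>0}$ and a rank $r_j\in\mathbb{Z}$ to each node $j\in J$, with associated allocation $x$ defined, for $i \in I$ and $j \in J$, by $$x_{ij}:=\begin{cases}\dfrac{S_i\,\alpha_j}{\sum_{j'\in N_r(i)}\alpha_{j'}} & \text{if } j\in N_r(i),\\[2ex] 0 & \text{otherwise,}\end{cases}$$ where $N_r(i):=\{j\in J : j\sim i \text{ and } r_j=\max_{j'\sim i} r_{j'}\}$ is the set of maximum-rank neighbors of $i$. The value of a piecewise proportional allocation with associated allocation $x$ is $\sum_{j\in J}\min\bigl(C_j,\sum_{i\sim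 j}x_{ij}\bigr)$. *)

(* Defs.v *)
From mathcomp Require Import all_boot all_order all_algebra.
From mathcomp Require Import reals.

Set Implicit Arguments.
Unset Strict Implicit.
Unset Printing Implicit Defensive.

Import Order.TTheory GRing.Theory Num.Theory.

Local Open Scope ring_scope.

(* A bipartite graph with sides I and J is given by its adjacency predicate   *)
(* adj : I -> J -> bool.                                                      *)

(* The allocation lives on the edges of the graph: values of x off the edges  *)
(* are irrelevant.                                                            *)
Definition perfect_integral_allocation (I J : finType) (adj : I -> J -> bool)
    (S : I -> nat) (C : J -> nat) (x : I -> J -> nat) : Prop :=
  (forall i : I, (\sum_(j : J | adj i j) x i j)%N = S i) /\
  (forall j : J, (\sum_(i : I | adj i j) x i j)%N = C j).

Record pp_allocation (R : realType) (J : finType) := PPAllocation {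
  pp_weight : J -> R;
  pp_rank : J -> int;
  pp_weight_gt0 : forall j : J, 0 < pp_weight j
}.

Definition max_rank_neighbors (I J : finType) (adj : I -> J -> bool)
    (r : J -> int) (i : I) : {set J} :=
  [set j : J | adj i j & [forall (j' | adj i j'), r j' <= r j]].

Definition pp_alloc (R : realType) (I J : finType) (adj : I -> J -> bool)
    (S : I -> nat) (P : pp_allocation R J) (i : I) (j : J) : R :=
  let N := max_rank_neighbors adj (pp_rank P) i in
  if j \in N
  then (S i)%:R * pp_weight P j / \sum_(j' in N) pp_weight P j'
  else 0.

Definition pp_value (R : realType) (I J : finType) (adj : I -> J -> bool)
    (S : I -> nat) (C : J -> nat) (P : pp_allocation R J) : R :=
  \sum_(j : J) Num.min (C j)%:R (\sum_(i : I | adj i j) pp_alloc adj S P i j).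

(* Main.v *)
(* Call T, a set of nodes of J, tight if the supplies whose neighbourhoods lie in
   T add up to the capacity of T.  Ranks come from a maximal chain of tight sets:
   a node outside a tight set has higher rank than those inside.  Within a layer
   of the chain all nonempty proper subsets have Hall slack at least 1.  In the
   box [d, 1] some weight vector overloads only nodes at the floor d and
   underloads only nodes at the ceiling 1.  If both occur and d is tiny, then the weights have a
   gap of a large ratio K; the nodes below the gap meet their capacity almost only
   from the supplies confined to them, against the slack.  So one kind of
   deviation is absent, and since the totals agree the other is absent too. *)
Require Import Defs.
From mathcomp Require Import all_boot all_order all_algebra.
From mathcomp Require Import reals.
From mathcomp Require Import ring lra.

Import Order.TTheory GRing.Theory Num.Theory.

Local Open Scope ring_scope.

(** * Proportional loads and the choice of weights within one layer *)

Definition load (R : realType) (I J : finType) (nb : I -> {set J}) (S : I -> R)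
    (a : J -> R) (j : J) : R :=
  \sum_(i | j \in nb i) S i * a j / \sum_(k in nb i) a k.

Section Load.
Variables (R : realType) (I J : finType) (nb : I -> {set J}) (S : I -> R).
Hypothesis S_ge0 : forall i, 0 <= S i.
Local Notation load := (load R I J nb S).

Lemma nb_weight_gt0 (a : J -> R) i j :
  (forall k, 0 < a k) -> j \in nb i -> 0 < \sum_(k in nb i) a k.
Proof.
move=> a_gt0 ji; rewrite (bigD1 j) //= ltr_pwDl //.
by apply: sumr_ge0 => k _; apply: ltW.
Qed.

Lemma load_ge0 (a : J -> R) j : (forall k, 0 < a k) -> 0 <= load a j.
Proof.
move=> a_gt0; apply: sumr_ge0 => i ji.
by rewrite divr_ge0 ?mulr_ge0 // ltW // (nb_weight_gt0 _ _ j).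
Qed.

(** Once the load of [j] is divided by the weight of [j], weights remain only in the denominators,
    which grow from [a] to [b]. *)
Lemma load_le_scale (a b : J -> R) j :
    (forall k, 0 < a k) -> (forall k, a k <= b k) ->
  load b j <= b j / a j * load a j.
Proof.
move=> a_gt0 ab; have b_gt0 k : 0 < b k by apply: lt_le_trans (ab k).
rewrite mulr_sumr; apply: ler_sum => i ji.
have sa := nb_weight_gt0 a i j a_gt0 ji.
have sb := nb_weight_gt0 b i j b_gt0 ji.
have -> : b j / a j * (S i * a j / \sum_(k in nb i) a k) =
          S i * b j / \sum_(k in nb i) a k.
  by field; rewrite !gt_eqF.
rewrite ler_wpM2l ?mulr_ge0 ?(ltW (b_gt0 j)) //.
by rewrite lef_pV2 // ler_sum.
Qed.

(* The load of j increases with the weight of j and decreases with all other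
   weights, so the weights in the box that overload no node above the floor d
   are closed under suprema; their coordinatewise supremum is the witness. *)
Lemma box_equilibrium (C : J -> R) (d : R) :
    (forall j, 0 < C j) -> 0 < d -> d <= 1 ->
  exists a : J -> R,
    [/\ forall j, d <= a j, forall j, a j < 1 -> C j <= load a j
      & forall j, d < a j -> load a j <= C j].
Proof.
move=> C_gt0 d_gt0 d_le1.
pose ok (a : J -> R) := (forall j, d <= a j <= 1) /\
  forall j, d < a j -> load a j <= C j.
pose E j : R -> Prop := fun t => exists2 a, ok a & t = a j.
have ok_d : ok (fun=> d) by split=> j; rewrite ?lexx ?d_le1 ?ltxx.
have supE j : classical_sets.has_sup (E j).
  split; first by exists d; exists (fun=> d).
  by exists 1 => _ [a [/(_ j)/andP[_ ?] _] ->].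
pose s j := sup (E j).
have le_s a j : ok a -> a j <= s j.
  by move=> ok_a; apply: ub_le_sup; [exact: (supE j).2 | exists a].
have s_ge j : d <= s j by apply: (le_s (fun=> d)).
have s_gt0 j : 0 < s j by apply: lt_le_trans (s_ge j).
have s_le1 j : s j <= 1.
  apply: ge_sup; first exact: (supE j).1.
  by move=> _ [a [/(_ j)/andP[_ ?] _] ->].
have s_load j : d < s j -> load s j <= C j.
  move=> ds; rewrite leNgt; apply/negP => Cl.
  have l_gt0 : 0 < load s j by apply: lt_trans Cl.
  (* An [ok] vector [a] with [a j > m] is above the floor at [j], so [load a j <= C j]; comparison
     with [s] then gives [a j <= s j * C j / load s j], against [a j > m]. *)
  pose m := Num.max d (s j * C j / load s j).
  have ms : m < s j.
    by rewrite gt_max ds /= ltr_pdivrMr // ltr_pM2l.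
  have sm_gt0 : 0 < s j - m by rewrite subr_gt0.
  have [_ [a ok_a ->]] := sup_adherent sm_gt0 (supE j).
  rewrite subKr gt_max => /andP[da sa].
  have a_gt0 k : 0 < a k by apply: lt_le_trans (andP (ok_a.1 k)).1.
  move: sa; apply/negP; rewrite -leNgt ler_pdivlMr //.
  have := load_le_scale a s j a_gt0 (fun k => le_s a k ok_a).
  have : s j / a j * load a j <= s j / a j * C j.
    by rewrite ler_wpM2l ?divr_ge0 ?(ltW (s_gt0 j)) ?(ltW (a_gt0 j)) // ok_a.2.
  move=> h1 h2; have := le_trans h2 h1.
  by rewrite mulrAC ler_pdivlMr // mulrC.
exists s; split=> // j s_lt1; rewrite leNgt; apply/negP => lC.
have l_ge0 := load_ge0 s j s_gt0.
have den : 0 < C j + load s j by rewrite ltr_pwDl.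
(* Raising [j] alone to [t] keeps the vector [ok], against the supremum. The factor exceeds 1 and
   brings the load to at most the harmonic mean of [C j] and [load s j], hence to at most [C j]; it
   also makes sense when the load is zero. *)
pose t := Num.min 1 (s j * (2 * C j / (C j + load s j))).
have st : s j < t.
  rewrite lt_min s_lt1 /= ltr_pMr // ltr_pdivlMr // mul1r; lra.
pose b k := if k == j then t else s k.
have sb k : s k <= b k by rewrite /b; case: eqP => // ->; apply: ltW.
suff ok_b : ok b.
  by have := le_s b j ok_b; rewrite /b eqxx leNgt st.
split=> k.
  rewrite (le_trans (s_ge k) (sb k)) /b; case: eqP => _ /=; last exact: s_le1.
  by rewrite ge_min lexx.
have bk : b k = if k == j then t else s k by [].
have := load_le_scale s b k s_gt0 sb; rewrite bk.
case: eqP => [->|_] h dk; last first.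
  by apply: le_trans h _; rewrite divff ?gt_eqF // mul1r s_load.
apply: le_trans h _.
have : t / s j <= 2 * C j / (C j + load s j).
  by rewrite ler_pdivrMr // mulrC ge_min lexx orbT.
move=> /(ler_wpM2r l_ge0) /le_trans; apply.
rewrite mulrAC ler_pdivrMr //; nra.
Qed.

Lemma sum_load (a : J -> R) (T : {set J}) :
  \sum_(j in T) load a j =
  \sum_i S i * (\sum_(j in T | j \in nb i) a j / \sum_(k in nb i) a k).
Proof.
rewrite (exchange_big_dep predT) //=; apply: eq_bigr => i _.
by rewrite mulr_sumr; apply: eq_bigr => j _; rewrite mulrA.
Qed.

End Load.

(** By integrality the strict Hall inequality is a slack of at least 1, more than can leak across a
    large weight gap. Zero supplies escape the condition on [nb], so a layer can be treated over all
    of [I]. *)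
Lemma exact_weights (R : realType) (I J : finType) (nb : I -> {set J})
    (S : I -> nat) (C : J -> nat) (D : {set J}) :
    (forall j, 0 < C j)%N ->
    (forall i, 0 < S i -> nb i != set0 /\ nb i \subset D)%N ->
    (\sum_i S i = \sum_(j in D) C j)%N ->
    (forall T : {set J}, T != set0 -> T \proper D ->
       \sum_(i | nb i \subset T) S i < \sum_(j in T) C j)%N ->
  exists a : J -> R, (forall j, 0 < a j) /\
    {in D, forall j, load R I J nb (fun i => (S i)%:R) a j = (C j)%:R}.
Proof.
move=> C_gt0 nbD SC slack.
(* Large enough that the total leak, [#|J| / K] times the total supply, is below 1. *)
pose K : R := ((\sum_i S i) * #|J| + 1)%:R.
have K_ge1 : 1 <= K by rewrite ler1n addn1.
have K_gt0 : 0 < K by apply: lt_le_trans K_ge1.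
have KJ_gt0 : 0 < K ^+ #|J| + 1 by rewrite addr_gt0 ?exprn_gt0.
(* Small enough that [#|J|] successive increases by the ratio [K] from [d] stay below 1. *)
pose d : R := (K ^+ #|J| + 1)^-1.
have d_gt0 : 0 < d by rewrite invr_gt0.
have d_le1 : d <= 1 by rewrite invf_le1 // lerDr exprn_ge0 // ltW.
have S_ge0 i : 0 <= (S i)%:R :> R by [].
have C_gt0R j : 0 < (C j)%:R :> R by rewrite ltr0n.
have [a [da lo hi]] := box_equilibrium R I J nb _ S_ge0 _ d C_gt0R d_gt0 d_le1.
have a_gt0 j : 0 < a j by apply: lt_le_trans (da j).
exists a; split=> //.
set l := load R I J nb _ a in lo hi *.
have sum_gt0 i : (0 < S i)%N -> 0 < \sum_(k in nb i) a k.
  by move=> /nbD[/set0Pn[j ji] _]; apply: nb_weight_gt0 ji.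
have total : \sum_(j in D) l j = \sum_(j in D) (C j)%:R.
  rewrite -natr_sum -SC natr_sum sum_load; apply: eq_bigr => i _.
  have [->|S_gt0] := posnP (S i); first by rewrite mul0r.
  have [_ /subsetP sD] := nbD i S_gt0.
  rewrite -mulr_suml (eq_bigl (mem (nb i))) => [|j]; last first.
    by rewrite /= andbC; case: (boolP (j \in nb i)) => //= /sD.
  by rewrite divff ?mulr1 // gt_eqF ?sum_gt0.
have tight (f g : J -> R) : {in D, forall j, f j <= g j} ->
    \sum_(j in D) f j = \sum_(j in D) g j -> {in D, forall j, f j = g j}.
  move=> fg sfg j jD; apply/eqP; rewrite eq_sym -subr_eq0.
  have /psumr_eq0P : forall k, k \in D -> 0 <= g k - f k.
    by move=> k kD; rewrite subr_ge0 fg.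
  by move=> -> //; rewrite sumrB sfg subrr.
(* If no node of [D] is at the floor, none is overloaded and equal totals force equality. *)
have [/existsP[j0 /andP[j0D /eqP aj0]]|no_lo] :=
    boolP [exists j, (j \in D) && (a j == d)]; last first.
  apply: tight => // j jD; apply: hi; rewrite lt_neqAle da andbT eq_sym.
  by apply: contra no_lo => aj; apply/existsP; exists j; rewrite jD.
(* Closing under steps of ratio at most [K] from the floor node [j0] places a gap of ratio above [K]
   between [T] and the rest of [D]. *)
pose e : rel J := fun j k => a k <= K * a j.
pose T := D :&: [set k | connect e j0 k].
have T_lo j : j \in T -> a j < 1.
  rewrite !inE => /andP[_ /connectP[p /shortenP[q eq uq _] ->]].
  have bound : forall x, path e x q -> a (last x q) <= K ^+ size q * a x.
    elim: (q) => [|y r IH] x /=; first by rewrite mul1r.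
    case/andP=> exy /IH /le_trans; apply.
    by rewrite exprSr -mulrA ler_wpM2l // exprn_ge0 // ltW.
  apply: le_lt_trans (bound _ eq) _; rewrite aj0 ltr_pdivrMr // mul1r.
  have sq : (size q <= #|J|)%N.
    by have := max_card (mem (j0 :: q)); rewrite (card_uniqP uq) => /ltnW.
  by rewrite (le_lt_trans (ler_weXn2l K_ge1 sq)) // ltrDl.
have T_gap j k : j \in T -> k \in D -> k \notin T -> K * a j < a k.
  rewrite !inE => /andP[_ j0j] -> /=; rewrite ltNge; apply: contra => ejk.
  exact: connect_trans j0j (connect1 ejk).
have T0 : T != set0 by apply/set0Pn; exists j0; rewrite !inE j0D connect0.
(* If there is no gap, every node of [D] is below the ceiling, so none is underloaded. *)
have [TD|TD] := eqVneq T D.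
  by move=> j jD; apply/esym/(tight (fun k => (C k)%:R)) => // k;
     rewrite -TD => /T_lo; apply: lo.
have {TD} TD : T \proper D by rewrite properEneq TD subsetIl.
(* Between integers this means that the confined supply covers the capacity of [T], contradicting
   [slack]. *)
suff : (\sum_(j in T) C j)%:R < (\sum_(i | nb i \subset T) S i)%:R + 1 :> R.
  by rewrite natr1 ltr_nat ltnS leqNgt slack.
rewrite natr_sum; apply: (@le_lt_trans _ _ (\sum_(j in T) l j)).
  by apply: ler_sum => j /T_lo; apply: lo.
rewrite sum_load.
(* A supply that sees some [k] outside [T] gives each node of [T] a share below [1 / K], as [a k]
   alone outweighs that node [K] times. *)
have part i : (S i)%:R * (\sum_(j in T | j \in nb i) a j / \sum_(k in nb i) a k)
    <= (if nb i \subset T then (S i)%:R else 0) + (S i * #|J|)%:R / K.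
  have [->|S_gt0] := posnP (S i); first by rewrite !mul0r addr0; case: ifP.
  have si := sum_gt0 i S_gt0.
  rewrite -mulr_suml; case: ifPn => [sT|/subsetPn[k ki kT]].
    apply: ler_wpDr; first by rewrite divr_ge0 // ltW.
    rewrite ger_pMr ?ltr0n // ler_pdivrMr // mul1r.
    rewrite [leRHS](eq_bigl (fun j => (j \in T) && (j \in nb i))) // => j.
    by rewrite andbC; case: (boolP (j \in nb i)) => //= /(subsetP sT).
  have kD : k \in D by apply: (subsetP (nbD i S_gt0).2).
  rewrite add0r natrM -mulrA ler_wpM2l // ler_pdivrMr // mulrAC ler_pdivlMr //.
  apply: (@le_trans _ _ (\sum_(j : J) a k)); last first.
    rewrite sumr_const cardT -cardE mulr_natl ler_wMn2r //.
    by rewrite (bigD1 k) //= lerDl sumr_ge0 // => j _; apply: ltW.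
  rewrite mulr_suml big_mkcond /=; apply: ler_sum => j _.
  case: ifP => [/andP[jT _]|_]; last exact: ltW.
  by rewrite mulrC ltW // T_gap.
apply: le_lt_trans (ler_sum _ (fun i _ => part i)) _.
rewrite big_split /= -big_mkcond natr_sum ltrD2l -mulr_suml -natr_sum.
by rewrite -big_distrl /= ltr_pdivrMr // mul1r ltr_nat addn1.
Qed.

(** * Tight sets and the recursive construction of ranks *)

Section TightSets.
Variables (R : realType) (I J : finType) (adj : I -> J -> bool).
Variables (S : I -> nat) (C : J -> nat).

Local Notation N i := [set j | adj i j].

Definition captive (T : {set J}) : {set I} := [set i | N i \subset T].

(** Hall's condition: in [x], captive supplies send everything into [T], which receives exactly its
    capacity. *)
Lemma captive_le (x : I -> J -> nat) (T : {set J}) :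
    perfect_integral_allocation adj S C x ->
  (\sum_(i in captive T) S i <= \sum_(j in T) C j)%N.
Proof.
move=> [xS xC].
have -> : (\sum_(j in T) C j = \sum_i \sum_(j in T | adj i j) x i j)%N.
  rewrite (exchange_big_dep (mem T)) /= => [|i j _ /andP[] //].
  by apply: eq_bigr => j jT; rewrite -xC; apply: eq_bigl => i; rewrite jT.
rewrite big_mkcond; apply: leq_sum => i _; case: ifP => //.
rewrite inE => /subsetP sT; rewrite -xS [leqRHS](eq_bigl (adj i)) // => j.
by rewrite andbC; case: (boolP (adj i j)) => // ij; apply: sT; rewrite inE.
Qed.

Hypothesis C_ge1 : forall j : J, (1 <= C j)%N.
Hypothesis hall : forall T : {set J},
  (\sum_(i in captive T) S i <= \sum_(j in T) C j)%N.

Definition tight (T : {set J}) : bool :=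
  (\sum_(i in captive T) S i == \sum_(j in T) C j)%N.

Lemma captiveS (A B : {set J}) : A \subset B -> captive A \subset captive B.
Proof. by move=> AB; apply/subsetP => i; rewrite !inE => /subset_trans; apply. Qed.

Lemma captive_bigD (A B : {set J}) : A \subset B ->
  (\sum_(i in captive B) S i =
   \sum_(i in captive A) S i + \sum_(i in captive B :\: captive A) S i)%N.
Proof.
by move=> /captiveS AB; rewrite (big_setID (captive A)) /= (setIidPr AB).
Qed.

(* Between a tight set and a maximal tight proper subset of it there is slack
   everywhere, so exact_weights applies to the layer; ranking the layer above
   the smaller set makes its nodes absorb all supply they can see. *)
Lemma tight_alloc (B : {set J}) : tight B ->
  exists P : pp_allocation R J,
    (forall j, j \in B -> pp_rank P j <= #|B|%:Z) /\
    (forall j, j \in B ->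
       \sum_(i in captive B | adj i j) pp_alloc adj S P i j = (C j)%:R).
Proof.
have [n] := ubnP #|B|; elim: n B => // n IH B /ltnSE Bn tB.
have [->|B0] := eqVneq B set0.
  exists (@PPAllocation R J (fun=> 1) (fun=> 0) (fun=> ltr01)).
  by split=> j; rewrite inE.
have t0 : tight set0.
  by have := hall set0; rewrite /tight big_set0 leqn0.
pose below (A : {set J}) := tight A && (A \proper B).
have below0 : below set0 by rewrite /below t0 proper0.
case: (arg_maxnP (fun A : {set J} => #|A|) below0) => A /andP[tA AB] maxA.
have sAB := proper_sub AB; have cAB := proper_card AB.
have [P [rP lP]] := IH A (leq_trans cAB Bn) tA.
pose L := captive B :\: captive A.
pose nb i := N i :\: A.
(* The layer is [B :\: A]: supplies outside [L] are set to zero, and those in [L] forget their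
   neighbours in [A]. *)
have [|||b [b_gt0 lb]] := exact_weights R I J nb
    (fun i => if i \in L then S i else 0%N) C (B :\: A) C_ge1.
- move=> i; case: ifP => // iL _; move: iL; rewrite !inE => /andP[iA iB].
  by split; [rewrite setD_eq0 | apply: setSD].
- move: tB tA; rewrite /tight (captive_bigD A B) // => /eqP tB /eqP tA.
  rewrite -big_mkcond; apply/eqP; move: tB.
  rewrite (big_setID A) /= (setIidPr sAB) tA => /eqP.
  by rewrite eqn_add2l.
(* Maximality of [A] prevents [A :|: T] from being tight; subtracting the equality for [A] from its
   strict Hall inequality leaves the slack of [T]. *)
- move=> T T0 TB; rewrite -big_mkcondr.
  have /subsetDP[sTB dTA] := proper_sub TB.
  have sAU : A \subset A :|: T := subsetUl A T.
  have UA : (A :|: T) :\: A = T by rewrite setDUl setDv set0U (setDidPl dTA).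
  have UB : A :|: T \proper B.
    rewrite properEneq subUset sAB sTB !andbT.
    by apply: contraTneq TB => <-; rewrite UA properxx.
  have AU : (#|A| < #|A :|: T|)%N.
    by rewrite -(cardsID A (A :|: T)) UA (setIidPr sAU) -addn1 leq_add2l card_gt0.
  have nU : ~~ tight (A :|: T).
    by apply: contraTN AU => tU; rewrite -leqNgt; apply: maxA; rewrite /below tU.
  have := hall (A :|: T); rewrite leq_eqVlt -/(tight _) (negPf nU) /=.
  rewrite (captive_bigD A) // (eqP tA) [ltnRHS](big_setID A) /=.
  rewrite (setIidPr sAU) UA ltn_add2l; congr (_ < _)%N.
  apply: eq_bigl => i; rewrite !inE -subDset -/(nb i).
  case: (boolP (nb i \subset T)) => //= iT; rewrite ?andbT ?andbF //.
  suff -> : N i \subset B by rewrite andbT.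
  by apply: subset_trans (proper_sub UB); rewrite -subDset.
pose w j := if j \in A then pp_weight P j else b j.
have w_gt0 j : 0 < w j by rewrite /w; case: ifP => _ //; apply: pp_weight_gt0.
(* Ranks inside [A] are at most [#|A|], so rank [#|B|] puts the new layer strictly on top. *)
pose Q := @PPAllocation R J w
  (fun j => if j \in A then pp_rank P j else #|B|%:Z) w_gt0.
exists Q; split=> [j jB|j jB] /=.
  by case: ifP => [/rP /le_trans->|//] //; rewrite lez_nat ltnW.
have QA i : i \in captive A -> pp_alloc adj S Q i j = pp_alloc adj S P i j.
  rewrite inE => /subsetP iA; rewrite /pp_alloc.
  have iA' k : adj i k -> k \in A by move=> ik; apply: iA; rewrite inE.
  have -> : max_rank_neighbors adj (pp_rank Q) i =
            max_rank_neighbors adj (pp_rank P) i.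
    apply/setP => k; rewrite !inE; case: (boolP (adj i k)) => //= ik.
    apply: eq_forallb => k'; case: (boolP (adj i k')) => //= ik'.
    by rewrite !iA'.
  have wP k : k \in max_rank_neighbors adj (pp_rank P) i -> w k = pp_weight P k.
    by rewrite inE => /andP[/iA' kA _]; rewrite /w kA.
  by case: ifP => // jm; rewrite /= wP // (eq_bigr _ wP).
(* A supply in [L] has a neighbour outside [A], whose rank beats all of [A]. *)
have QL i : i \in L -> max_rank_neighbors adj (pp_rank Q) i = nb i.
  rewrite !inE => /andP[/subsetPn[k]]; rewrite inE => ik kA /subsetP iB.
  apply/setP => k'; rewrite !inE /=; case: (boolP (adj i k')); last first.
    by rewrite andbF.
  move=> ik' /=; rewrite andbT; case: ifPn => k'A /=.
    apply/forallP => /(_ k); rewrite ik (negPf kA) /= => kk'.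
    by have := le_trans kk' (rP _ k'A); rewrite lez_nat leqNgt cAB.
  apply/forallP => k''; apply/implyP => _; case: ifP => // /rP /le_trans -> //.
  by rewrite lez_nat ltnW.
have -> : \sum_(i in captive B | adj i j) pp_alloc adj S Q i j =
    \sum_(i in captive A | adj i j) pp_alloc adj S P i j +
    \sum_(i in L | adj i j) pp_alloc adj S Q i j.
  rewrite (bigID (mem (captive A))) /=; congr (_ + _).
    apply: eq_big => [i|i /andP[_ /QA] //]; rewrite andbAC; congr (_ && _).
    case: (boolP (i \in captive A)); rewrite ?andbF // andbT.
    by move=> /(subsetP (captiveS _ _ sAB)) ->.
  by apply: eq_bigl => i; rewrite /L in_setD andbC andbA.
have [jA|jA] := boolP (j \in A).
  rewrite lP // [X in _ + X]big1 ?addr0 // => i /andP[iL _].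
  by rewrite /pp_alloc QL // !inE jA.
rewrite big1 ?add0r => [|i]; last first.
  rewrite inE => /andP[/subsetP iA ij].
  by have := iA j; rewrite inE ij (negPf jA) => /(_ isT).
rewrite -lb ?inE ?jA // /load [LHS]big_mkcond [RHS]big_mkcond /=.
apply: eq_bigr => i _.
have -> : (j \in nb i) = adj i j by rewrite !inE jA.
rewrite andbC; case: ifPn => [/andP[ij iL]|].
  rewrite ij iL /pp_alloc QL // !inE jA ij /= /w (negPf jA); congr (_ / _).
  by apply: eq_bigr => k; rewrite !inE => /andP[/negPf-> _].
by rewrite negb_and; case: (adj i j) => //= /negPf ->; rewrite !mul0r.
Qed.

End TightSets.

Theorem theorem3p4 (R : realType) (I J : finType) (adj : I -> J -> bool)
    (S : I -> nat) (C : J -> nat)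
    (S_ge1 : forall i : I, (1 <= S i)%N)
    (C_ge1 : forall j : J, (1 <= C j)%N)
    (perfect : exists x : I -> J -> nat,
       perfect_integral_allocation adj S C x) :
  (\sum_(i : I) S i)%N = (\sum_(j : J) C j)%N /\
  exists P : pp_allocation R J,
    pp_value adj S C P = ((\sum_(i : I) S i)%N)%:R.
Proof.
have [x xP] := perfect; have [xS xC] := xP.
have SC : (\sum_(i : I) S i = \sum_(j : J) C j)%N.
  rewrite -(eq_bigr _ (fun i _ => xS i)) -(eq_bigr _ (fun j _ => xC j)).
  exact: exchange_big_dep.
have captT : captive I J adj setT = setT.
  by apply/setP => i; rewrite !inE subsetT.
(* Every supply is captive in [setT], so tightness there is the equality of totals. *)
have tT : tight I J adj S C setT.
  rewrite /tight captT (eq_bigl xpredT) => [|i]; last by rewrite inE.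
  by rewrite SC; apply/eqP/eq_bigl => j; rewrite inE.
have [P [_ lP]] := tight_alloc R I J adj S C C_ge1
  (fun T => captive_le I J adj S C x T xP) setT tT.
split=> //; exists P; rewrite /pp_value SC natr_sum; apply: eq_bigr => j _.
rewrite (_ : \sum_(i | adj i j) _ = (C j)%:R) ?minxx // -(lP j) ?inE //.
by apply: eq_bigl => i; rewrite captT inE.
Qed.
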